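(* Let $(X,I)$ be a Polish ideal space. Suppose that a family $\mathcal{A}\subseteq I$ satisfies the following conditions: (1) $\bigcup\mathcal{A}=X$; (2) for all $x,y\in X$, if $x\neq y$ then $|\mathcal{A}_x\cap\mathcal{A}_y|\le\omega$; (3) $\mathrm{cov}_h(\mathcal{A})=2^{\omega}$. Then there exists a subfamily $\mathcal{A}_0\subseteq\mathcal{A}$ such that $\bigcup\mathcal{A}_0$ is $(X,I)$-nonmeasurable.
   Context: A pair $(X,I)$ is a Polish ideal space if $X$ is an uncountable Polish space and $I\subseteq P(X)$ is a proper $\sigma$-ideal containing all at most countable subsets of $X$ and having a Borel base, i.e. every $A\in I$ is contained in some Borel set $B\subseteq X$ with $B\in I$. $B_+(I)$ denotes the family of all Borel subsets of $X$ that do not belong to $I$. For a family $\mathcal{A}$ of subsets of $X$ and $x\in X$, $\mathcal{A}_x=\{A\in\mathcal{A}: x\in A\}$. $\mathrm{cov}_h(\mathcal{A})=\min\{|\mathcal{B}|: \mathcal{B}\subseteq\mathcal{A}\text{ and there is } B\in B_+(I)\text{ with } B\subseteq\bigcup\mathcal{B}\}$. $B[I]$ denotes the least $\sigma$-field containing all Borel subsets of $X$ and all members of $I$; equivalently $B[I]=\{B\bigtriangleup A: B\text{ Borel in }X,\ A\in I\}$. A set $A\subseteq X$ is $(X,I)$-nonmeasurable if $A\notin B[I]$. *)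

(* Defs.v *)
From HB Require Import structures.
From mathcomp Require Import all_boot all_order all_algebra.
From mathcomp Require Import all_classical all_reals all_analysis.

Set Implicit Arguments.
Unset Strict Implicit.
Unset Printing Implicit Defensive.

Local Open Scope classical_set_scope.
Local Open Scope card_scope.

Definition separable (X : topologicalType) : Prop :=
  exists2 D : set X, countable D & dense D.

(* The library's [completeType] is pointed and carries no distance, hence this
   predicate on metric spaces. *)
Definition complete_metric (R : realType) (M : metricType R) : Prop :=
  forall F : set_system M, ProperFilter F -> cauchy F -> exists x : M, F --> x.

Definition completely_metrizable (R : realType) (X : topologicalType) : Prop :=
  exists (M : metricType R) (f : X -> M) (g : M -> X),
    [/\ cancel f g, cancel g f, continuous f, continuous g & complete_metric M].

Definition polish (R : realType) (X : topologicalType) : Prop :=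
  separable X /\ completely_metrizable R X.

Definition borel (X : topologicalType) : set (set X) := <<s @open X >>.

Definition sigma_ideal (X : Type) (I : set (set X)) : Prop :=
  [/\ I set0,
      forall A B : set X, B `<=` A -> I A -> I B &
      forall F : (set X)^nat, (forall n, I (F n)) -> I (\bigcup_n F n)].

Record polish_ideal_space (R : realType) (X : topologicalType)
    (I : set (set X)) : Prop := PolishIdealSpace {
  pis_polish : polish R X ;
  pis_uncountable : ~ countable [set: X] ;
  pis_sigma_ideal : sigma_ideal I ;
  pis_proper : ~ I [set: X] ;
  pis_countable : forall A : set X, countable A -> I A ;
  pis_borel_base : forall A : set X, I A ->
    exists B : set X, [/\ borel B, I B & A `<=` B] }.

Definition borel_pos (X : topologicalType) (I : set (set X)) : set (set X) :=
  [set B | borel B /\ ~ I B].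

Definition family_at (X : Type) (A : set (set X)) (x : X) : set (set X) :=
  [set a | A a /\ a x].

Definition covers_borel_pos (X : topologicalType) (I A B : set (set X)) : Prop :=
  B `<=` A /\ exists2 C, borel_pos I C & C `<=` \bigcup_(b in B) b.

(* There is no type of cardinals: [cov_h_eq I A K] says that the minimum
   defining cov_h(A) is attained and equals the cardinality of [K]. *)
Definition cov_h_eq (X : topologicalType) (I A : set (set X))
    (U : Type) (K : set U) : Prop :=
  (exists2 B, covers_borel_pos I A B & B #= K) /\
  (forall B, covers_borel_pos I A B -> K #<= B).

Definition ideal_measurable (X : topologicalType) (I : set (set X)) :
    set (set X) :=
  <<s @borel X `|` I >>.

(* Main.v *)
Require Import Defs.
From HB Require Import structures.
From mathcomp Require Import all_boot all_order all_algebra.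
From mathcomp Require Import all_classical all_reals all_analysis.
From mathcomp Require wochoice.
From Stdlib Require Import Wellfounded Relation_Operators.

Set Implicit Arguments.
Unset Strict Implicit.
Unset Printing Implicit Defensive.

Local Open Scope classical_set_scope.
Local Open Scope card_scope.

Import Order.TTheory GRing.Theory Num.Theory.

(** The subfamily is built as a Bernstein set is. Write c for the continuum and
call a set small when its cardinality is below c. There are only c Borel
sets ([card_borel]), so they can be listed along a well-order all of whose
proper initial segments are small. Running through the positive Borel subsets
B of a fixed positive Borel set B0, one picks at each stage a member a of the
family that meets B and a point d of B, so that no chosen member ever contains
a chosen point. The union U of the chosen members and its complement then both
meet every positive Borel subset of B0 ([bernstein_selection]), whereas a
measurable set is Borel modulo the ideal, and hence contains or misses such a
subset ([nonmeasurable_of_bernstein]).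

At each stage the small set of earlier members does not cover B, because
cov_h is c; this yields the point d. The member a must avoid the small set E
of chosen points, that is, lie outside the union of the A_e for e in E, and
this is where the countable intersections enter.

- Suppose that for every small E and every positive B some x in B, outside E,
  has A_x of cardinality not at most |E| times aleph_0. Each A_x meets A_e in
  a countable set, so the A_e with e in E cannot exhaust A_x, and any remaining
  member of A_x serves as a.
- Otherwise there are a positive B0 and a small D such that the A_x, for x in
  B0 outside D, all have cardinality at most that of one small set K. The
  points d are taken in B0 outside D, which is possible since D itself is
  covered by a small subfamily. The union of the A_e, for e in E, then has at
  most |E| |K| members, so it is small and does not cover B; any member
  through an uncovered point of B serves as a.

Both cases need a product of two small sets to be small
([below_continuum_setX]), even when c is a singular cardinal. This is
Hessenberg's theorem for the initial segments of a well-order of type c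
([card_segment_square]). *)

(** * Comparing cardinalities *)

Lemma inj_on_card_le (T U : Type) (A : set T) (B : set U) (f : T -> U) :
  {homo f : x / A x >-> B x} ->
  (forall x y, A x -> A y -> f x = f y -> x = y) -> A #<= B.
Proof.
move=> fAB finj.
have [g] : $|{injfun A >-> B}|.
  apply/injfunPex; exists f => // x y; rewrite !inE => Ax Ay; exact: finj.
exact: inj_card_le.
Qed.

Lemma card_le_inj_on (T U : Type) (A : set T) (B : set U) :
  A #<= B -> A !=set0 -> exists2 f : T -> U, {homo f : x / A x >-> B x} &
    (forall x y, A x -> A y -> f x = f y -> x = y).
Proof.
elim/Ppointed: U => U in B *.
  by rewrite ?emptyE => -> [].
move=> /pcard_leP[f] _; exists f => [x Ax|x y Ax Ay]; first exact: funS.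
by apply: inj; rewrite inE.
Qed.

Lemma card_le_setX (T T' U U' : Type) (A : set T) (A' : set T') (B : set U)
  (B' : set U') : A #<= A' -> B #<= B' -> A `*` B #<= A' `*` B'.
Proof.
move=> AA' BB'; have [->|/set0P[[a b] /= [Aa Bb]]] := eqVneq (A `*` B) set0.
  exact: card_ge0.
have [f fA finj] := card_le_inj_on AA' (ex_intro _ a Aa).
have [g gB ginj] := card_le_inj_on BB' (ex_intro _ b Bb).
apply: (@inj_on_card_le _ _ _ _ (fun p => (f p.1, g p.2))).
  by move=> [x y] /= [Ax By]; split; [exact: fA|exact: gB].
move=> [x y] [x' y'] /= [Ax By] [Ax' By'] [exx' eyy'].
by congr pair; [exact: finj|exact: ginj].
Qed.

(** Sends a point s to (e, g_e s), where e is a chosen index with s in F e and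
g_e is a chosen injection on the part of A lying in F e. *)
Lemma card_bigcup_le (E S L : Type) (D : set E) (F : E -> set S) (K : set L)
  (A : set S) : A `<=` \bigcup_(e in D) F e ->
  (forall e, D e -> A `&` F e #<= K) -> A #<= D `*` K.
Proof.
move=> AF FK; have [->|/set0P[a Aa]] := eqVneq A set0; first exact: card_ge0.
have [e0 De0 Fa] := AF _ Aa.
have [ix Dix] : exists e : S -> E, forall s, A s -> D (e s) /\ F (e s) s.
  have /choice[e He] : forall s, exists e, A s -> D e /\ F e s.
    move=> s; have [As|nAs] := pselect (A s); last by exists e0.
    by have [e De Fe] := AF _ As; exists e.
  by exists e.
have [l0 _ _] := card_le_inj_on (FK _ De0) (ex_intro _ a (conj Aa Fa)).
have /choice[g Hg] : forall e, exists g : S -> L, D e ->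
    {homo g : x / (A `&` F e) x >-> K x} /\
    (forall x y, (A `&` F e) x -> (A `&` F e) y -> g x = g y -> x = y).
  move=> e; have [De|nDe] := pselect (D e); last by exists l0.
  have [E0|/set0P AFe] := eqVneq (A `&` F e) set0.
    by exists l0 => _; rewrite E0; split=> [x []|x y []].
  by have [g ? ?] := card_le_inj_on (FK _ De) AFe; exists g.
apply: (@inj_on_card_le _ _ _ _ (fun s => (ix s, g (ix s) s))).
  by move=> s As; have [De Fe] := Dix _ As; split=> //=; apply: (Hg _ De).1.
move=> x y Ax Ay [exy]; have [Dx Fx] := Dix _ Ax; have [Dy Fy] := Dix _ Ay.
rewrite -exy in Fy *; exact: (Hg _ Dx).2.
Qed.

(** * Well-orders and transfinite recursion *)

Record strict_well_order (T : Type) (lt : T -> T -> Prop) : Prop := {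
  swo_wf : well_founded lt ;
  swo_total : forall x y, [\/ lt x y, x = y | lt y x] }.

(** Transitivity follows from totality: otherwise x, y, z would form a cycle of
length two or three, which well-foundedness excludes. *)
Lemma swo_trans (T : Type) (lt : T -> T -> Prop) :
  strict_well_order lt -> forall x y z, lt x y -> lt y z -> lt x z.
Proof.
move=> [wf tot] x y z xy yz.
have no2 a b : lt a b -> lt b a -> False.
  elim/(well_founded_ind wf): a b => a IH b ab ba; exact: (IH b ba a).
have no3 a b c : lt a b -> lt b c -> lt c a -> False.
  elim/(well_founded_ind wf): a b c => a IH b c ab bc ca; exact: (IH c ca a b).
have [//|xz|zx] := tot x z; first by subst z; case: (no2 x y).
by case: (no3 x y z).
Qed.

Lemma swo_preimage (T U : Type) (lt : U -> U -> Prop) (f : T -> U) :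
  injective f -> strict_well_order lt ->
  strict_well_order (fun x y => lt (f x) (f y)).
Proof.
move=> finj [wf tot]; split; first exact: wf_inverse_image.
by move=> x y; have [|/finj|] := tot (f x) (f y);
  [constructor 1|constructor 2|constructor 3].
Qed.

Lemma swo_lex (T U : Type) (lt : T -> T -> Prop) (lt' : U -> U -> Prop) :
  strict_well_order lt -> strict_well_order lt' ->
  strict_well_order (slexprod T U lt lt').
Proof.
move=> [wf tot] [wf' tot']; split; first exact: wf_slexprod.
move=> [x x'] [y y']; have [xy|<-|yx] := tot x y.
- by constructor 1; left.
- have [xy|<-|yx] := tot' x' y'; [constructor 1; by right|by constructor 2|].
  by constructor 3; right.
- by constructor 3; left.
Qed.

Lemma swo_exists (T : Type) :
  exists lt : T -> T -> Prop, strict_well_order lt.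
Proof.
have [R woR] := wochoice.well_ordering_principle {classic T}.
have minP (A : set T) : A !=set0 -> exists2 z, A z & forall t, A t -> R z t.
  move=> [x Ax]; have [|z [[zA zmin] _]] := woR (fun t => `[< A t >]).
    by exists x; apply/asboolP.
  by exists z => [|t At]; [exact/asboolP|apply: zmin; exact/asboolP].
have refl x : R x x.
  by have [z -> /(_ x erefl)] := minP [set x] (ex_intro _ x erefl).
have anti x y : R x y -> R y x -> x = y.
  move=> Rxy Ryx; have [|z [_ uniq]] := woR (fun t => `[< [set x; y] t >]).
    by exists x; apply/asboolP; left.
  transitivity z; [symmetry|]; apply: uniq; split.
  - by apply/asboolP; left.
  - by move=> t /asboolP[->|->].
  - by apply/asboolP; right.
  - by move=> t /asboolP[->|->].
exists (fun x y => R x y /\ x <> y); split.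
  move=> x; apply: contrapT => nx.
  have [z nz zmin] := minP [set x | ~ Acc (fun x y => R x y /\ x <> y) x]
    (ex_intro _ x nx).
  apply: nz; constructor=> y [Ryz nyz]; apply: contrapT => /zmin Rzy.
  by apply: nyz; exact: anti.
move=> x y; have [->|nxy] := pselect (x = y); first by constructor 2.
have [z [->|->] zmin] := minP [set x; y] (ex_intro _ x (or_introl erefl)).
- by constructor 1; split=> //; apply: zmin; right.
- by constructor 3; split=> [|/esym//]; apply: zmin; left.
Qed.

(** The relation R t S y constrains the value y at t only through the set S of
earlier values, so the recursive call never has to mention their indices. *)
Lemma transfinite_choice (T Y : Type) (lt : T -> T -> Prop)
    (R : T -> set Y -> Y -> Prop) : well_founded lt ->
  (forall t S, exists y, R t S y) ->
  exists G : T -> Y, forall t, R t (G @` [set s | lt s t]) (G t).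
Proof.
move=> wf RE.
have [c cR] : exists c, forall t S, R t S (c t S).
  suff /choice[c cR] : forall t, exists f, forall S, R t S (f S) by exists c.
  by move=> t; have [f Rf] := choice (RE t); exists f.
(* [Fix] provides earlier values only together with a proof that their index
   is smaller, hence the existential over such proofs. *)
pose step t (rec : forall s, lt s t -> Y) : Y :=
  c t [set y | exists s (h : lt s t), rec s h = y].
pose G := Fix wf (fun=> Y) step.
have GE t : G t = step t (fun s _ => G s).
  apply: (Fix_eq wf (fun=> Y)) => x f g fg; rewrite /step; congr c.
  by apply/seteqP; split=> y [s [h <-]]; exists s, h; rewrite fg.
exists G => t; rewrite GE /step.
suff <- : [set y | exists s (_ : lt s t), G s = y] = G @` [set s | lt s t].
  exact: cR.
by apply/seteqP; split=> y [s h];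
  [case: h => h <-; exists s|move=> <-; exists s, h].
Qed.

(** Choosing for each p a value in Q that differs from all earlier ones never
gets stuck, as the earlier values are too few to exhaust Q. *)
Lemma card_le_of_segments (T U : Type) (lt : T -> T -> Prop) (P : set T)
    (Q : set U) : strict_well_order lt ->
  (forall p, P p -> ~ (Q #<= P `&` [set q | lt q p])) -> P #<= Q.
Proof.
move=> [wf tot] small; have [->|/set0P[p0 Pp0]] := eqVneq P set0.
  exact: card_ge0.
have [q0 Qq0] : Q !=set0.
  by apply/set0P/eqP => Q0; apply: (small _ Pp0); rewrite Q0; exact: card_ge0.
pose ltP q p := P q /\ lt q p.
have wfP : well_founded ltP.
  by apply: wf_incl wf => q p [].
have [p S|G GP] := @transfinite_choice _ U ltP (fun p S y =>
    (exists y, Q y /\ ~ S y) -> Q y /\ ~ S y) wfP.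
  by have [[y Hy]|H] := pselect (exists y, Q y /\ ~ S y); [exists y|exists q0].
have {}GP p : P p -> Q (G p) /\ ~ (G @` [set q | ltP q p]) (G p).
  move=> Pp; apply: GP; apply: contrapT => noy.
  apply: (small _ Pp); apply: card_le_trans (card_image_le G _).
  apply: subset_card_le => y Qy; apply: contrapT => nSy; apply: noy.
  by exists y.
apply: (@inj_on_card_le _ _ _ _ G) => [p /GP[]//|p q Pp Pq Gpq].
have [pq|//|qp] := tot p q.
- by case: (GP _ Pq) => _; case; exists p.
- by case: (GP _ Pp) => _; case; exists q.
Qed.

(** In any well-order of T, either all proper segments are smaller than T, or T
injects into a least one that is not; the order of that segment, pulled back
along the injection, has the required property. *)
Lemma initial_order_exists (T : Type) :
  exists2 lt : T -> T -> Prop, strict_well_order lt &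
    forall t, ~ ([set: T] #<= [set s | lt s t]).
Proof.
have [lt wo] := swo_exists T.
have [|] := pselect (forall t, ~ ([set: T] #<= [set s | lt s t])).
  by exists lt.
move=> /existsNP[t /contrapT]; elim/(well_founded_ind (swo_wf wo)): t => t IH Tt.
have [[s [st Ts]]|nos] :=
    pselect (exists s, lt s t /\ [set: T] #<= [set r | lt r s]).
  exact: IH st Ts.
have [f ft finj] := card_le_inj_on Tt (ex_intro _ t Logic.I).
exists (fun x y => lt (f x) (f y)).
  by apply: swo_preimage wo => x y; exact: finj.
move=> x Tx; apply: nos; exists (f x); split; first exact: ft.
apply: card_le_trans Tx _; apply: (@inj_on_card_le _ _ _ _ f) => // y z _ _.
exact: finj.
Qed.

(** * Hessenberg's theorem *)

Lemma card_le_closed_segment (T : Type) (lt : T -> T -> Prop) (m : T) :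
  infinite_set [set s | lt s m] ->
  [set s | lt s m \/ s = m] #<= [set: bool] `*` [set s | lt s m].
Proof.
move=> inf; apply: (@card_bigcup_le _ _ _ _
  (fun b : bool => if b then [set s | lt s m] else [set m])).
  by move=> s [sm|->]; [exists true|exists false].
move=> [] _; first by apply: subset_card_le; exact: subIsetr.
apply: card_le_trans (subset_card_le (@subIsetr _ _ _)) _.
apply: card_le_trans (finite_set_countable (finite_set1 m)) _; exact/infiniteP.
Qed.

(** Hessenberg's theorem, by induction on t. If a smaller segment is already
as large as that of t, the induction hypothesis applies to it. Otherwise the
pairs are ordered by their maximum first: the pairs preceding a given pair lie
in the square of a closed segment below t, by induction that square is smaller
than the segment of t, and [card_le_of_segments] concludes. *)
Lemma card_segment_square (T : Type) (lt : T -> T -> Prop) :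
  strict_well_order lt -> forall t, infinite_set [set s | lt s t] ->
  [set s | lt s t] `*` [set s | lt s t] #<= [set s | lt s t].
Proof.
move=> wo t; elim/(well_founded_ind (swo_wf wo)): t => t IH inft.
have ltT := swo_trans wo.
pose seg t := [set s | lt s t].
have [[s [st ts]]|nos] := pselect (exists s, lt s t /\ seg t #<= seg s).
  have infs : infinite_set (seg s).
    by move/infiniteP: inft => Nt; apply/infiniteP; exact: card_le_trans Nt ts.
  apply: card_le_trans (card_le_setX ts ts) _.
  apply: card_le_trans (IH _ st infs) _.
  by apply: subset_card_le => r rs; exact: ltT rs st.
pose m x y := if `[< lt x y >] then y else x.
have le_m x y : (lt x (m x y) \/ x = m x y) /\ (lt y (m x y) \/ y = m x y).
  rewrite /m; case: asboolP => xy; first by split; [left|right].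
  by split; [right|have [//|->|] := swo_total wo x y; [right|left]].
(* The pair itself is appended to its maximum to make the order total. *)
pose key p := (m p.1 p.2, p).
pose lt2 p q := slexprod _ _ lt (slexprod _ _ lt lt) (key p) (key q).
apply: (@card_le_of_segments _ _ lt2).
  have keyI : injective key by move=> p q /(congr1 snd).
  exact: (swo_preimage keyI (swo_lex wo (swo_lex wo wo))).
move=> p [/= p1 p2] tp; set n := m p.1 p.2.
have nt : lt n t by rewrite /n /m; case: asboolP.
have {}tp : seg t #<= [set s | lt s n \/ s = n] `*` [set s | lt s n \/ s = n].
  apply: card_le_trans tp _; apply: subset_card_le => q [_ qp].
  have mqn : lt (m q.1 q.2) n \/ m q.1 q.2 = n.
    by move: qp; rewrite /lt2 /key; inversion 1; [left|right].
  have [q1 q2] := le_m q.1 q.2.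
  split=> /=.
    by case: q1 => [q1|->//]; case: mqn => [/(ltT _ _ _ q1)|<-]; left.
  by case: q2 => [q2|->//]; case: mqn => [/(ltT _ _ _ q2)|<-]; left.
have [fin|infn] := pselect (finite_set (seg n)).
  have finn : finite_set (seg n `|` [set n]) by rewrite finite_setU.
  by apply: inft; apply: card_le_finite tp _; exact: finite_setX.
have nn := IH _ nt infn.
have cn : [set s | lt s n \/ s = n] #<= seg n.
  apply: card_le_trans (card_le_closed_segment infn) _.
  apply: card_le_trans nn; apply: card_le_setX => //.
  apply: card_le_trans (finite_set_countable _) _; first exact: finite_finset.
  exact/infiniteP.
apply: nos; exists n; split=> //.
apply: card_le_trans tp _; apply: card_le_trans nn; exact: card_le_setX.
Qed.

(** * Sets of cardinality below the continuum *)

Definition below_continuum (T : Type) (A : set T) := ~ ([set: set nat] #<= A).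

Lemma below_continuum_le (T U : Type) (A : set T) (B : set U) :
  A #<= B -> below_continuum B -> below_continuum A.
Proof. by move=> AB smB cA; apply: smB; exact: card_le_trans cA AB. Qed.

Lemma countable_below_continuum (T : Type) (A : set T) :
  countable A -> below_continuum A.
Proof.
move=> cA cont; have cN := card_le_trans cont cA.
have [f _ finj] := card_le_inj_on cN (ex_intro _ set0 Logic.I).
(* Cantor's diagonal set, for an injection of the power set into nat. *)
pose D := [set n | exists2 a, f a = n & ~ a n].
have [Dn|nDn] := pselect (D (f D)).
  by have [a fa na] := Dn; rewrite (finj a D) // in na.
by apply: (nDn); exists D.
Qed.

(** Otherwise every segment of lt is too small to absorb A, and then
[card_le_of_segments] injects the continuum into A. *)
Lemma below_continuum_segment (lt : set nat -> set nat -> Prop) (T : Type)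
    (A : set T) : strict_well_order lt -> below_continuum A ->
  exists t, A #<= [set s | lt s t].
Proof.
move=> wo smA; apply: contrapT => noseg; apply: smA.
apply: (card_le_of_segments wo) => t _ At; apply: noseg; exists t.
by apply: card_le_trans At _; apply: subset_card_le; exact: subIsetr.
Qed.

Lemma below_continuum_common_segment (lt : set nat -> set nat -> Prop)
    (T U : Type) (A : set T) (B : set U) :
  strict_well_order lt -> below_continuum A -> below_continuum B ->
  exists t, A #<= [set s | lt s t] /\ B #<= [set s | lt s t].
Proof.
move=> wo smA smB.
have [a Aa] := below_continuum_segment wo smA.
have [b Bb] := below_continuum_segment wo smB.
have [ab|ab|ba] := swo_total wo a b.
- exists b; split=> //; apply: card_le_trans Aa _.
  by apply: subset_card_le => s sa; exact: swo_trans wo _ _ _ sa ab.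
- by exists b; rewrite -ab in Bb *.
- exists a; split=> //; apply: card_le_trans Bb _.
  by apply: subset_card_le => s sb; exact: swo_trans wo _ _ _ sb ba.
Qed.

Lemma below_continuum_setX (T U : Type) (A : set T) (B : set U) :
  below_continuum A -> below_continuum B -> below_continuum (A `*` B).
Proof.
move=> smA smB; have [lt wo seg_lt] := initial_order_exists (set nat).
have [t [At Bt]] := below_continuum_common_segment wo smA smB.
apply: below_continuum_le (card_le_setX At Bt) _.
have [fin|inf] := pselect (finite_set [set s | lt s t]).
  exact/countable_below_continuum/finite_set_countable/finite_setX.
apply: below_continuum_le (card_segment_square wo inf) _; exact: seg_lt.
Qed.

Lemma below_continuum_setU (T : Type) (A B : set T) :
  below_continuum A -> below_continuum B -> below_continuum (A `|` B).
Proof.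
move=> smA smB; have [lt wo seg_lt] := initial_order_exists (set nat).
have [t [At Bt]] := below_continuum_common_segment wo smA smB.
apply: (@below_continuum_le _ _ _ ([set: bool] `*` [set s | lt s t])).
  apply: (@card_bigcup_le _ _ _ _ (fun b : bool => if b then A else B)).
    by move=> x [Ax|Bx]; [exists true|exists false].
  move=> [] _; [apply: card_le_trans At|apply: card_le_trans Bt];
    by apply: subset_card_le; exact: subIsetr.
apply: below_continuum_setX; last exact: seg_lt.
exact/countable_below_continuum/finite_set_countable/finite_finset.
Qed.

(** * The transfinite selection *)

(** The sets of PB are treated one after another along a well-order with
segments below the continuum. At each of them one selects a point of P that is
in no earlier member, and then a member that contains neither that point nor
any earlier one; the two requirements together separate all selected members
from all selected points, whatever their order of selection. *)
Lemma bernstein_selection (X : Type) (A PB : set (set X)) (P : set X) :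
  PB #<= [set: set nat] ->
  (forall E B, E `<=` P -> below_continuum E -> PB B ->
    exists a, [/\ A a, B `&` a !=set0 & E `&` a = set0]) ->
  (forall A' B, A' `<=` A -> below_continuum A' -> PB B ->
    (B `&` P) `\` \bigcup_(a in A') a !=set0) ->
  exists2 A0, A0 `<=` A & forall B, PB B ->
    B `&` \bigcup_(a in A0) a !=set0 /\ B `\` \bigcup_(a in A0) a !=set0.
Proof.
move=> PBc choose_a choose_d; have [PB0|/set0P[B0 PB0]] := eqVneq PB set0.
  by exists set0 => //; rewrite PB0.
have below0 Y : below_continuum (@set0 Y).
  exact/countable_below_continuum/countable0.
have [x0 _] := choose_d set0 B0 (sub0set _) (below0 _) PB0.
have [lt wo seg_lt] := initial_order_exists {B | PB B}.
pose valid (t : {B | PB B}) (S : set (set X * X)) (y : set X * X) :=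
  [/\ A y.1, P y.2, sval t y.2, sval t `&` y.1 !=set0 &
    [/\ ~ y.1 y.2, forall s, S s -> ~ s.1 y.2 & forall s, S s -> ~ y.1 s.2]].
have [t S|G GP] := @transfinite_choice _ (set X * X)%type lt (fun t S y =>
    fst @` S `<=` A -> snd @` S `<=` P -> below_continuum S -> valid t S y)
    (swo_wf wo).
  have [[SA SP smS]|H] := pselect [/\ fst @` S `<=` A, snd @` S `<=` P &
      below_continuum S]; last first.
    by exists (set0, x0) => SA SP smS; exfalso; apply: H.
  case: t => B PBB.
  have [|d [[Bd Pd] dS]] := choose_d (fst @` S) B SA _ PBB.
    exact: below_continuum_le (card_image_le _ _) smS.
  have [||a [Aa Ba Ea]] := choose_a (d |` snd @` S) B _ _ PBB.
  - by move=> x [->|/SP].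
  - apply: below_continuum_setU; first exact/countable_below_continuum/countable1.
    exact: below_continuum_le (card_image_le _ _) smS.
  exists (a, d) => _ _ _; split=> //=; split.
  - move=> ad; have : ((d |` snd @` S) `&` a) d by split=> //; left.
    by rewrite Ea.
  - by move=> s Ss sd; apply: dS; exists s.1 => //; exists s.
  - move=> s Ss sd; have : ((d |` snd @` S) `&` a) s.2.
      by split=> //; right; exists s.
    by rewrite Ea.
have below_seg t : below_continuum (G @` [set s | lt s t]).
  apply: below_continuum_le (card_image_le _ _) _ => cont.
  apply: (seg_lt t); apply: card_le_trans cont; apply: card_le_trans PBc.
  apply: (@inj_on_card_le _ _ _ _ sval) => [[]//|x y _ _]; exact: eq_sig_hprop.
(* The recursion guarantees validity only when the earlier choices lie in A and
   P, which holds by induction. *)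
have {}GP t : valid t (G @` [set s | lt s t]) (G t).
  elim/(well_founded_ind (swo_wf wo)): t => t IH; apply: GP => //.
    by move=> _ [_ [s st <-] <-]; have [] := IH s st.
  by move=> _ [_ [s st <-] <-]; have [] := IH s st.
exists (range (fst \o G)) => [_ [t _ <-]|B PBB]; first by have [] := GP t.
have [_ _ Bd [x [Bx ax]] _] := GP (exist _ B PBB).
split.
  by exists x; split=> //; exists (G (exist _ B PBB)).1.
exists (G (exist _ B PBB)).2; split=> //; move=> [_ [s _ <-] /=].
have [st|->|ts] := swo_total wo s (exist _ B PBB).
- by have [_ _ _ _ [_ + _]] := GP (exist _ B PBB); apply; exists s.
- by have [_ _ _ _ []] := GP (exist _ B PBB).
- by have [_ _ _ _ [_ _]] := GP s; apply; exists (exist _ B PBB).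
Qed.

(** * Measurability modulo the ideal *)

(** The Borel base makes it possible to enclose the error in a Borel set N of
the ideal, so that removing N from a Borel set leaves a Borel set. *)
Lemma ideal_measurable_mod_borel (X : topologicalType) (I : set (set X)) :
  sigma_ideal I ->
  (forall A, I A -> exists B, [/\ borel B, I B & A `<=` B]) ->
  forall U, ideal_measurable I U -> exists C N,
    [/\ borel C, borel N, I N, U `\` C `<=` N & C `\` U `<=` N].
Proof.
move=> [I0 Isub Ibig] Ibase; have b0 : borel (set0 : set X).
  exact: sigma_algebra0.
apply: smallest_sub => [|U [bU|IU]]; last 2 first.
- by exists U, set0; split=> //; rewrite setDv.
- have [N [bN IN UN]] := Ibase _ IU.
  by exists set0, N; split=> //; [rewrite setD0|rewrite set0D].
split=> [|U [C [N [bC bN IN UC CU]]]|F FP].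
- by exists set0, set0; split=> //; rewrite setDv.
- exists (~` C), N; split=> //; first by rewrite -setTD; exact: sigma_algebraCD.
    by move=> x [[_ nUx] /contrapT Cx]; exact: CU.
  by move=> x [nCx nUx]; apply: UC; split=> //; apply: contrapT => nU; exact: nUx.
- have /choice[C /choice[N CN]] : forall n, exists C N,
    [/\ borel C, borel N, I N, F n `\` C `<=` N & C `\` F n `<=` N] := FP.
  exists (\bigcup_n C n), (\bigcup_n N n); split.
  + by apply: sigma_algebra_bigcup => n; have [] := CN n.
  + by apply: sigma_algebra_bigcup => n; have [] := CN n.
  + by apply: Ibig => n; have [] := CN n.
  + move=> x [[n _ Fx] nCx]; exists n => //; have [_ _ _ FC _] := CN n.
    by apply: FC; split=> // Cx; apply: nCx; exists n.
  + move=> x [[n _ Cx] nFx]; exists n => //; have [_ _ _ _ CF] := CN n.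
    by apply: CF; split=> // Fx; apply: nFx; exists n.
Qed.

Lemma borelD (X : topologicalType) (A B : set X) :
  borel A -> borel B -> borel (A `\` B).
Proof.
move=> bA bB; rewrite -[A `\` B]setCK setCD -setTD -bigcup2E.
apply: sigma_algebraCD; apply: sigma_algebra_bigcup => -[|[|n]] /=.
- by rewrite -setTD; exact: sigma_algebraCD.
- exact: bB.
- exact: sigma_algebra0.
Qed.

Lemma sigma_idealU (X : Type) (I : set (set X)) (A B : set X) :
  sigma_ideal I -> I A -> I B -> I (A `|` B).
Proof.
by move=> [I0 _ Ibig] IA IB; rewrite -bigcup2E; apply: Ibig => -[|[|n]].
Qed.

(** If U were equal to a Borel set C up to a Borel set N of the ideal, then one
of the Borel sets (B0 minus N) minus C and (B0 minus N) inside C would be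
positive; the former misses U and the latter is contained in U. *)
Lemma nonmeasurable_of_bernstein (X : topologicalType) (I : set (set X))
    (B0 U : set X) : sigma_ideal I ->
  (forall A, I A -> exists B, [/\ borel B, I B & A `<=` B]) ->
  borel_pos I B0 ->
  (forall B, borel_pos I B -> B `<=` B0 -> B `&` U !=set0 /\ B `\` U !=set0) ->
  ~ ideal_measurable I U.
Proof.
move=> sI Ibase [bB0 nIB0] bern mU; have [_ Isub _] := sI.
have [C [N [bC bN IN UC CU]]] := ideal_measurable_mod_borel sI Ibase mU.
have bD1 := borelD (borelD bB0 bN) bC.
have bD2 := borelD (borelD bB0 bN) bD1.
have [ID1|nID1] := pselect (I ((B0 `\` N) `\` C)); last first.
  have [|[x [[[_ nNx] nCx] Ux]] _] := bern _ (conj bD1 nID1).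
    by move=> x [[]].
  by apply: nNx; exact: UC.
have nID2 : ~ I ((B0 `\` N) `\` ((B0 `\` N) `\` C)).
  move=> ID2; apply: nIB0.
  apply: Isub (sigma_idealU sI IN (sigma_idealU sI ID1 ID2)) => x Bx.
  have [Nx|nNx] := pselect (N x); [by left|right].
  by have [D1x|nD1x] := pselect (((B0 `\` N) `\` C) x); [left|right].
have [|_ [x [[[Bx nNx] nD1x] nUx]]] := bern _ (conj bD2 nID2).
  by move=> x [[]].
have Cx : C x by apply: contrapT => nCx; apply: nD1x.
by apply: nNx; exact: CU.
Qed.

(** * The number of Borel sets *)

(** Borel codes: a function on finite sequences is read as a labelled tree,
whose root label says whether the tree denotes a basic set (whose index is the
label at [:: 0]), the complement of the set denoted by its 0-th subtree, or the
union of the sets denoted by its subtrees. *)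
Inductive coded (X : Type) (V : nat -> set X) :
    (seq nat -> nat) -> set X -> Prop :=
| coded_basic c : c [::] = 0%N -> coded V c (V (c [:: 0%N]))
| coded_compl c S : c [::] = 1%N -> coded V (fun s => c (0%N :: s)) S ->
    coded V c (~` S)
| coded_union c (F : nat -> set X) : c [::] = 2%N ->
    (forall n, coded V (fun s => c (n :: s)) (F n)) ->
    coded V c (\bigcup_n F n).

Lemma coded_functional (X : Type) (V : nat -> set X) c S S' :
  coded V c S -> coded V c S' -> S = S'.
Proof.
move=> cS; elim: cS S' => {c S} [c c0|c S c0 _ IH|c F c0 _ IH] S' cS'.
- by case: cS' c0 => {c S'} [//|c S -> //|c F -> //].
- case: cS' c0 IH => {c S'} [c -> //|c S' _ cS' _ IH|c F -> //].
  by rewrite (IH _ cS').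
- case: cS' c0 IH => {c S'} [c -> //|c S' -> //|c F' _ cF' _ IH].
  by apply: eq_bigcupr => n _; exact: IH.
Qed.

Lemma sigma_algebra_coded (X : Type) (V : nat -> set X) :
  sigma_algebra setT [set S | exists c, coded V c S].
Proof.
have codedC S : (exists c, coded V c S) -> exists c, coded V c (~` S).
  by move=> [c cS]; exists (fun s => if s is n :: s' then c s' else 1%N);
    constructor.
have codedU (F : nat -> set X) : (forall n, exists c, coded V c (F n)) ->
    exists c, coded V c (\bigcup_n F n).
  move=> /choice[c cF].
  by exists (fun s => if s is n :: s' then c n s' else 2%N); constructor.
split=> [|S cS|]; [|by rewrite setTD; exact: codedC|exact: codedU].
have cV : exists c, coded V c (V 0%N).
  by exists (fun=> 0%N); exact: (@coded_basic _ V (fun=> 0%N)).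
rewrite /= -[set0]setCK; apply: (codedC).
have -> : ~` set0 = \bigcup_n (if n is 0%N then V 0%N else ~` V 0%N).
  apply/seteqP; split=> x _; last by move=> [].
  have [Vx|nVx] := pselect (V 0%N x).
    by exists 0%N.
  by exists 1%N.
by apply: codedU => -[|n] //; exact: codedC.
Qed.

(** A code is recovered from its graph, a set of pairs drawn from a countable
set. *)
Lemma card_codes : [set: seq nat -> nat] #<= [set: set nat].
Proof.
pose graph (c : seq nat -> nat) := [set pickle (s, c s) | s in [set: seq nat]].
apply: (@inj_on_card_le _ _ _ _ graph) => // c c' _ _ cc'.
apply/funext => s.
have : graph c' (pickle (s, c s)).
  by rewrite -cc'; exists s.
by move=> [s' _ /(pcan_inj pickleK)[-> ->]].
Qed.

Lemma card_borel (X : topologicalType) :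
  @second_countable X -> @borel X #<= [set: set nat].
Proof.
move=> [B /pcard_surjP[V BV] [_ Bbase]].
have [c0 _ cU] := sigma_algebra_coded V.
have cV n : exists c, coded V c (V n).
  (* The root has label 0, the label at [:: 0] is the index of the set. *)
  pose c (s : seq nat) := if s is [::] then 0%N else n.
  by exists c; exact: (@coded_basic _ V c).
have borel_coded : @borel X `<=` [set S | exists c, coded V c S].
  apply: smallest_sub => [|O oO]; first exact: sigma_algebra_coded.
  have -> : O = \bigcup_n (if `[< V n `<=` O >] then V n else set0).
    apply/seteqP; split=> [x Ox|x [n _]]; last by case: asboolP => // /(_ x).
    have [_ [/BV[n _ <-] Vx] VO] := Bbase x _ (open_nbhs_nbhs (conj oO Ox)).
    by exists n => //; case: asboolP.
  by apply: cU => n; case: ifP => _; [exact: cV|exact: c0].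
apply: card_le_trans card_codes.
have /choice[k kP] : forall S : set X, exists c, borel S -> coded V c S.
  move=> S; have [/borel_coded[c cS]|nb] := pselect (borel S); first by exists c.
  by exists (fun=> 0%N).
apply: (@inj_on_card_le _ _ _ _ k) => // S S' bS bS' kk.
by apply: coded_functional (kP _ bS) _; rewrite kk; exact: kP.
Qed.

(** The interiors of the balls of radius 1/(n+1) around the points of a countable
dense set form a base. *)
Lemma polish_second_countable (R : realType) (X : topologicalType) :
  polish R X -> @second_countable X.
Proof.
move=> [[D Dc Dd] [M [f [g [fK gK fc gc _]]]]].
pose B d n := f @^-1` (ball (f d) (n.+1%:R^-1 : R)%R)^°.
have oB d n : open (B d n).
  by apply: open_comp => [x _|]; [exact: fc|exact: open_interior].
exists (\bigcup_(d in D) range (B d)).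
  apply: bigcup_countable => // d _.
  exact: sub_countable (card_image_le _ _) (card_lexx _).
split=> [_ [d _ [n _ <-]]//|x O Ox].
have [e /= e0 eO] : exists2 e : R, (0 < e)%R & ball (f x) e `<=` g @^-1` O.
  by apply/nbhs_ballP; apply: gc; rewrite fK.
have [n ne] : exists n, (n.+1%:R^-1 <= e / 2 :> R)%R.
  have [n] := ltr_add_invr (divr_gt0 e0 (ltr0n R 2)).
  by rewrite add0r => /ltW; exists n.
set r : R := n.+1%:R^-1%R in ne.
have r0 : (0 < r / 2)%R by rewrite divr_gt0// invr_gt0.
(* The centre d is at distance less than r/2 from x, so that x lies in the
   interior of the ball of radius r around d. *)
have [||d [Wd dD]] := Dd (f @^-1` (ball (f x) (r / 2)%R)^°).
- by exists x; exact: nbhsx_ballx.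
- by apply: open_comp => [y _|]; [exact: fc|exact: open_interior].
have {}Wd : ball (f x) (r / 2)%R (f d) := interior_subset Wd.
exists (B d n); first split; first by exists d => //; exists n.
  have : nbhs (f x) (ball (f x) (r / 2)%R) by exact: nbhsx_ballx.
  by apply: filterS => y xy; exact: ball_splitr Wd xy.
move=> y /interior_subset By.
rewrite -[y]fK; apply: eO; apply: (@le_ball _ _ _ (r / 2 + r)%R); last first.
  exact: ball_triangle Wd By.
rewrite [leRHS]splitr lerD//; apply: le_trans ne.
by rewrite ler_pdivrMr// ler_peMr ?ler1n// ltW// invr_gt0.
Qed.

(** * The nonmeasurable union *)

Theorem theorem2p2 (R : realType) (X : topologicalType) (I : set (set X))
    (hI : polish_ideal_space R I) (A : set (set X)) (hAI : A `<=` I)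
    (hcover : \bigcup_(a in A) a = [set: X])
    (hcount : forall x y : X, x <> y ->
       countable (family_at A x `&` family_at A y))
    (hcov : cov_h_eq I A [set: set nat]) :
  exists2 A0 : set (set X), A0 `<=` A &
    ~ ideal_measurable I (\bigcup_(a in A0) a).
Proof.
have Xsc := polish_second_countable (pis_polish hI).
have sI := pis_sigma_ideal hI; have Ibase := pis_borel_base hI.
have noncover A' B : A' `<=` A -> below_continuum A' -> borel_pos I B ->
    B `\` \bigcup_(a in A') a !=set0.
  move=> A'A smA' posB; apply: contrapT => cov; apply: smA'; apply: hcov.2.
  split=> //; exists B => // x Bx; apply: contrapT => nx; apply: cov.
  by exists x.
have [a_ a_P] : exists a_ : X -> set X, forall x, A (a_ x) /\ a_ x x.
  suff /choice[a_ ?] : forall x, exists a, A a /\ a x by exists a_.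
  move=> x; have [a Aa ax] : (\bigcup_(a in A) a) x by rewrite hcover.
  by exists a.
(* B0 is the positive set that receives the construction, P the set of points
   that may be selected. *)
suff [B0 [P [posB0 choose_a choose_d]]] : exists B0 P,
  [/\ borel_pos I B0,
  (forall E B, E `<=` P -> below_continuum E -> borel_pos I B -> B `<=` B0 ->
    exists a, [/\ A a, B `&` a !=set0 & E `&` a = set0]) &
  (forall A' B, A' `<=` A -> below_continuum A' -> borel_pos I B -> B `<=` B0 ->
    (B `&` P) `\` \bigcup_(a in A') a !=set0)].
  have [|E B EP smE [pB BB0]|A' B A'A smA' [pB BB0]|A0 A0A bern] :=
    @bernstein_selection X A [set B | borel_pos I B /\ B `<=` B0] P.
  - apply: card_le_trans (card_borel Xsc); apply: subset_card_le.
    by move=> B [[]].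
  - exact: choose_a.
  - exact: choose_d.
  exists A0 => //; apply: (nonmeasurable_of_bernstein sI Ibase posB0).
  by move=> B pB BB0; exact: bern.
(* Either the families A_x are uniformly small on a positive set up to a small
   set D, or there are large A_x wherever they are needed. *)
have [[B0 [D [K [posB0 smD smK AK]]]]|nocase] :=
    pselect (exists B0 (D : set X) (K : set (X * nat)),
      [/\ borel_pos I B0, below_continuum D, below_continuum K &
       forall x, (B0 `\` D) x -> family_at A x #<= K]).
  exists B0, (B0 `\` D); split=> // [E B EP smE posB BB0|A' B A'A smA' posB BB0].
    have [|||x [Bx nx]] := noncover (\bigcup_(e in E) family_at A e) B.
    - by move=> a [e _ []].
    - apply: below_continuum_le (below_continuum_setX smE smK).
      apply: card_bigcup_le (@subset_refl _ _) _ => e Ee.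
      apply: card_le_trans (AK e (EP _ Ee)); apply: subset_card_le.
      exact: subIsetr.
    - exact: posB.
    have [Aa ax] := a_P x; exists (a_ x); split=> //; first by exists x.
    rewrite -subset0 => e [Ee ae]; apply: nx; exists (a_ x) => //.
    by exists e.
  (* Adding one member through each point of D keeps the new point off D. *)
  have [|||x [Bx nx]] := noncover (A' `|` a_ @` D) B.
  - by move=> a [/A'A//|[x _ <-]]; have [] := a_P x.
  - apply: below_continuum_setU => //.
    exact: below_continuum_le (card_image_le _ _) smD.
  - exact: posB.
  exists x; split.
    split=> //; split; first exact: BB0.
    move=> Dx; apply: nx; exists (a_ x); last by have [] := a_P x.
    by right; exists x.
  by move=> [a A'a ax]; apply: nx; exists a => //; left.
exists setT, setT; split.
- split; last exact: pis_proper hI.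
  by apply: sub_gen_smallest; exact: openT.
- move=> E B _ smE posB _.
  (* Failure of the first case, for D := E and K := E x nat. *)
  have [x [[Bx nEx] nAx]] : exists x, (B `\` E) x /\
      ~ (family_at A x #<= E `*` [set: nat]).
    apply: contrapT => nox; apply: nocase; exists B, E, (E `*` [set: nat]).
    split=> //.
      exact/below_continuum_setX/countable_below_continuum/card_lexx.
    by move=> x BEx; apply: contrapT => nAx; apply: nox; exists x.
  apply: contrapT => noa; apply: nAx.
  apply: (@card_bigcup_le _ _ _ _ (family_at A)).
    move=> a [Aa ax]; apply: contrapT => na; apply: noa; exists a; split=> //.
      by exists x.
    by rewrite -subset0 => e [Ee ae]; apply: na; exists e.
  by move=> e Ee; apply: hcount => xe; apply: nEx; rewrite xe.
- move=> A' B A'A smA' posB _; rewrite setIT; exact: noncover.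
Qed.
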